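(* Let $X$ be a topological space, $(Z,\lambda)$ a metrizable equiconnected space and $g\in B_1(X,Z)$. Then there exists a separately continuous mapping $f:X^2\to Z$ with the diagonal $g$, i.e. $f(x,x)=g(x)$ for every $x\in X$.
   Context: An equiconnected space is a pair $(Z,\lambda)$ consisting of a topological space $Z$ and a continuous function $\lambda:Z\times Z\times[0,1]\to Z$ such that $\lambda(x,y,0)=x$, $\lambda(x,y,1)=y$ and $\lambda(x,x,t)=x$ for all $x,y\in Z$ and $t\in[0,1]$. It is metrizable if the topological space $Z$ is metrizable. $B_1(X,Z)$ is the collection of all Baire-one mappings $g:X\to Z$, i.e. mappings for which there is a sequence of continuous mappings $g_n:X\to Z$ with $\lim_{n\to\infty}g_n(x)=g(x)$ for every $x\in X$. A mapping $f:X^2\to Z$ is separately continuous if for every $y\in X$ the mapping $x\mapsto f(x,y)$ is continuous and for every $x\in X$ the mapping $y\mapsto f(x,y)$ is continuous. *)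

(* Defs.v *)
From HB Require Import structures.
From mathcomp Require Import all_boot all_order all_algebra.
From mathcomp Require Import all_classical all_reals topology.

Set Implicit Arguments.
Unset Strict Implicit.
Unset Printing Implicit Defensive.

Import Order.TTheory GRing.Theory Num.Theory.
Import numFieldTopology.Exports.

Local Open Scope classical_set_scope.
Local Open Scope ring_scope.

Definition is_metric (R : realType) (Z : Type) (d : Z -> Z -> R) : Prop :=
  [/\ forall x y, 0 <= d x y,
      forall x y, d x y = 0 <-> x = y,
      forall x y, d x y = d y x
    & forall x y z, d x z <= d x y + d y z].

Definition metrizable (R : realType) (Z : topologicalType) : Prop :=
  exists2 d : Z -> Z -> R, is_metric d &
    forall U : set Z, open U <->
      forall x, U x -> exists2 e : R, 0 < e & [set y | d x y < e] `<=` U.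

(* The unit interval as a type of its own, with the topology induced by R
   through the inclusion [\val : unit_interval R -> R]. *)
Notation unit_interval R := (set_type `[0%R : Real.sort R, 1%R]%classic).

Definition equiconnected (R : realType) (Z : topologicalType)
    (lambda : Z * Z * unit_interval R -> Z) : Prop :=
  [/\ continuous lambda,
      forall x y (t : unit_interval R), \val t = 0 -> lambda (x, y, t) = x,
      forall x y (t : unit_interval R), \val t = 1 -> lambda (x, y, t) = y
    & forall x (t : unit_interval R), lambda (x, x, t) = x].

Definition B1 (X Z : topologicalType) : set (X -> Z) :=
  [set g | exists2 g_ : nat -> X -> Z, forall n, continuous (g_ n) &
             forall x, g_ n x @[n --> \oo] --> g x].

Arguments B1 X Z _ : clear implicits.

Definition separately_continuous (X Y Z : topologicalType)
    (f : X * Y -> Z) : Prop :=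
  (forall y, continuous (fun x => f (x, y))) /\
  (forall x, continuous (fun y => f (x, y))).

(* Main.v *)
(* Let [g_n --> g] pointwise and let [D_n(x, y)] be the sum of the distances
   [d (g_k x) (g_k y)] for [k <= n]. Start at [g_0 x] and, at the [n]-th step,
   move along [lambda] towards [g_(n+1) x] with a continuous parameter that is
   1 when [D_(n+1) <= 2 ^- n] and 0 when [D_(n+1) >= 2 * 2 ^- n]. Let [f (x, y)]
   be the limit of these points. Where some [D_n] is positive, the process is
   stationary from a locally constant rank, so [f] is jointly continuous.
   If all [D_n(x, y)] vanish, nothing ever stops and [f (x, y) = g x = g y].
   Near such a point with one coordinate equal to [p], the process follows
   [g_n x] up to a large rank and stops while [g_n x] is still close to [g_n p],
   hence to [g p]; compactness of the interval controls the last step. *)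

Require Import Defs.
From HB Require Import structures.
From mathcomp Require Import all_boot all_order all_algebra.
From mathcomp Require Import all_classical all_reals topology.
From mathcomp Require Import normedtype lra.

Set Implicit Arguments.
Unset Strict Implicit.
Unset Printing Implicit Defensive.

Import Order.TTheory GRing.Theory Num.Theory.
Import numFieldNormedType.Exports.

Local Open Scope classical_set_scope.
Local Open Scope ring_scope.

(** * Neighbourhoods, limits and separation in terms of the metric *)

Section metric.
Context {R : realType} {Z : topologicalType} {d : Z -> Z -> R}.
Hypothesis d_metric : is_metric d.
Hypothesis d_open : forall U : set Z, open U <->
  forall x, U x -> exists2 e : R, 0 < e & [set y | d x y < e] `<=` U.

Let d_ge0 x y : 0 <= d x y. Proof. by case: d_metric. Qed.
Let d_sym x y : d x y = d y x. Proof. by case: d_metric. Qed.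
Let d_tri y x z : d x z <= d x y + d y z. Proof. by case: d_metric. Qed.
Let dxx x : d x x = 0. Proof. by case: d_metric => _ d0 _ _; apply/d0. Qed.

Lemma metric_small_eq x y : (forall e, 0 < e -> d x y < e) -> x = y.
Proof.
move=> small; case: d_metric => _ d0 _ _; apply/d0/le_anti.
rewrite d_ge0 andbT leNgt; apply/negP => /small.
by rewrite ltxx.
Qed.

Lemma nbhs_metricP (z : Z) (U : set Z) :
  nbhs z U <-> exists2 e : R, 0 < e & [set y | d z y < e] `<=` U.
Proof.
split.
  rewrite nbhsE => -[V [/d_open oV Vz] VU].
  by have [e e0 eV] := oV z Vz; exists e => //; exact: subset_trans VU.
move=> [e e0 eU]; rewrite nbhsE; exists [set y | d z y < e] => //.
split; last by rewrite /= dxx.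
apply/d_open => x /= zx; exists (e - d z x); first by rewrite subr_gt0.
move=> y /=; rewrite ltrBrDl; exact: le_lt_trans (d_tri x z y).
Qed.

Lemma cvg_metricP {T : Type} {F : set_system T} {FF : Filter F}
    (h : T -> Z) (z : Z) :
  h t @[t --> F] --> z <-> forall e, 0 < e -> \forall t \near F, d z (h t) < e.
Proof.
split=> [hz e e0|hz U /nbhs_metricP[e e0 eU]].
  by apply: (hz [set y | d z y < e]); apply/nbhs_metricP; exists e.
by apply: filterS (hz e e0) => t /eU.
Qed.

Lemma metric_hausdorff : hausdorff_space Z.
Proof.
move=> x y xy; apply: metric_small_eq => e e0.
have e20 : 0 < e / 2 by rewrite divr_gt0.
have nb z : nbhs z [set t | d z t < e / 2].
  by apply/nbhs_metricP; exists (e / 2).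
have [z [/= xz yz]] := xy _ _ (nb x) (nb y).
by have := d_tri z x y; rewrite (d_sym z); lra.
Qed.

Lemma continuous_metric {T : topologicalType} (h k : T -> Z) :
  continuous h -> continuous k -> continuous (fun t => d (h t) (k t)).
Proof.
move=> ch ck t; apply/cvgrPdist_lt => e e0.
have e20 : 0 < e / 2 by rewrite divr_gt0.
have /cvg_metricP/(_ _ e20) ht := ch t.
have /cvg_metricP/(_ _ e20) kt := ck t.
apply: filterS2 ht kt => s hs ks; rewrite ltr_norml.
have := d_tri (h s) (h t) (k t); have := d_tri (k s) (h s) (k t).
have := d_tri (h t) (h s) (k s); have := d_tri (k t) (h t) (k s).
by rewrite (d_sym (k s) (k t)) (d_sym (h s) (h t)); lra.
Qed.

End metric.

(** * Retraction of the real line onto the unit interval *)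

Section clamp.
Context {R : realType}.

Lemma clamp_subproof (r : R) : `[0, 1]%classic (Num.min 1 (Num.max 0 r)).
Proof. by rewrite /= in_itv /= le_min ler01 ge_min lexx le_max lexx. Qed.

Definition clamp (r : R) : unit_interval R :=
  SigSub (mem_set (clamp_subproof r)).

Lemma val_clamp r : \val (clamp r) = Num.min 1 (Num.max 0 r).
Proof. by []. Qed.

Lemma clamp0 r : r <= 0 -> \val (clamp r) = 0.
Proof. by move=> r0; rewrite val_clamp (max_idPl r0) (min_idPr ler01). Qed.

Lemma clamp1 r : 1 <= r -> \val (clamp r) = 1.
Proof.
by move=> r1; rewrite val_clamp; apply/min_idPl; rewrite le_max r1 orbT.
Qed.

Lemma clampK (t : unit_interval R) : clamp (\val t) = t.
Proof.
apply/val_inj; rewrite val_clamp.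
have : `[0, 1]%classic (\val t) by apply: set_mem; exact: valP.
by rewrite /= in_itv /= => /andP[t0 t1]; rewrite (max_idPr t0) (min_idPr t1).
Qed.

Lemma continuous_clamp : continuous clamp.
Proof.
apply: continuous_comp_initial => r.
apply: (@continuous_min R R (cst 1)); first exact: cvg_cst.
by apply: (@continuous_max R R (cst 0)) => //; exact: cvg_cst.
Qed.

End clamp.

(** A tube lemma: [lambda] is constantly [z] on the slice over [(z, z)], so each parameter has a
    good neighbourhood, and compactness of the interval makes one neighbourhood of [(z, z)] serve
    all parameters. *)
Lemma equiconnected_tube (R : realType) (Z : topologicalType)
    (lambda : Z * Z * unit_interval R -> Z) (z : Z) (U : set Z) :
  equiconnected lambda -> nbhs z U ->
  \forall ab \near (z, z), forall t, U (lambda (ab, t)).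
Proof.
move=> [lc _ _ lid] Uz.
have /compact_near_coveringP cov := @segment_compact R 0 1.
have loc (r : R) : `[0, 1]%classic r ->
    \forall r' \near r & ab \near (z, z), U (lambda (ab, clamp r')).
  move=> _.
  have cr : lambda (x.2, clamp x.1) @[x --> (r, (z, z))] --> z.
    rewrite -[X in _ --> X](lid z (clamp r)).
    apply: (@cvg_comp _ _ _ (fun x : R * (Z * Z) => (x.2, clamp x.1)) lambda
      _ (nbhs (z, z, clamp r))); last exact: lc.
    apply: (@cvg_pair _ _ _ _ (nbhs (z, z)) (nbhs (clamp r))).
      exact: cvg_snd.
    exact: (cvg_comp fst clamp cvg_fst (@continuous_clamp R r)).
  exact: cr.
move: cov => /(_ _ (nbhs (z, z))
  (fun ab r => U (lambda (ab, clamp r))) _ loc) cov.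
apply: filterS cov => ab sab t; rewrite -[t]clampK; apply: sab.
by apply: set_mem; exact: valP.
Qed.

(** * The interpolating sequence and its limit *)

Section interpolation.
Context {R : realType} {X Z : topologicalType}.
Context {lambda : Z * Z * unit_interval R -> Z} {d : Z -> Z -> R}.
Context {g_ : nat -> X -> Z} {g : X -> Z}.
Hypothesis lambda_equi : equiconnected lambda.
Hypothesis d_metric : is_metric d.
Hypothesis d_open : forall U : set Z, open U <->
  forall x, U x -> exists2 e : R, 0 < e & [set y | d x y < e] `<=` U.
Hypothesis g_cont : forall n, continuous (g_ n).
Hypothesis g_lim : forall x, g_ n x @[n --> \oo] --> g x.

Let d_ge0 x y : 0 <= d x y. Proof. by case: d_metric. Qed.
Let d_sym x y : d x y = d y x. Proof. by case: d_metric. Qed.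
Let d_tri y x z : d x z <= d x y + d y z. Proof. by case: d_metric. Qed.
Let dxx x : d x x = 0. Proof. by case: d_metric => _ d0 _ _; apply/d0. Qed.

(** Summing over all ranks up to [n], instead of taking the last distance alone, makes this monotone
    in [n], so a process that has stopped never restarts. *)
Definition gap n (q : X * X) : R := \sum_(k < n.+1) d (g_ k q.1) (g_ k q.2).

Fixpoint interp n (q : X * X) : Z :=
  if n is m.+1 then
    lambda (interp m q, g_ n q.1, clamp (2 - 2 ^+ m * gap n q))
  else g_ 0 q.1.

Lemma gap_ge0 n q : 0 <= gap n q.
Proof. exact: sumr_ge0. Qed.

Lemma gap_le m n q : (m <= n)%N -> gap m q <= gap n q.
Proof.
move=> /subnK <-; elim: (n - m)%N => [//|k]; move/le_trans; apply.
by rewrite addSn {2}/gap big_ord_recr lerDl.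
Qed.

Lemma dist_le_gap k n q : (k <= n)%N -> d (g_ k q.1) (g_ k q.2) <= gap n q.
Proof.
move=> kn; apply: le_trans (gap_le q kn).
by rewrite /gap big_ord_recr /= lerDr sumr_ge0.
Qed.

Lemma continuous_gap n : continuous (gap n).
Proof.
have dc k : continuous (fun q : X * X => d (g_ k q.1) (g_ k q.2)).
  apply: (continuous_metric d_metric d_open) => q.
    exact: (cvg_comp fst (g_ _) cvg_fst (@g_cont k q.1)).
  exact: (cvg_comp snd (g_ _) cvg_snd (@g_cont k q.2)).
elim: n => [|n IH].
  suff -> : gap 0 = fun q => d (g_ 0 q.1) (g_ 0 q.2) by [].
  by apply/funext => q; rewrite /gap big_ord1.
suff -> : gap n.+1 = fun q => gap n q + d (g_ n.+1 q.1) (g_ n.+1 q.2).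
  by move=> q; exact: (cvgD (IH q) (dc n.+1 q)).
by apply/funext => q; rewrite /gap big_ord_recr.
Qed.

Lemma continuous_scaled_gap n : continuous (fun q => 2 ^+ n * gap n.+1 q).
Proof. by move=> q; apply: cvgM; [exact: cvg_cst | exact: continuous_gap]. Qed.

Lemma continuous_interp n : continuous (interp n).
Proof.
elim: n => [|n IH] q /=.
  exact: (cvg_comp fst (g_ _) cvg_fst (@g_cont 0 q.1)).
case: lambda_equi => lc _ _ _.
apply: (@continuous_comp _ _ _ (fun q => (interp n q, g_ n.+1 q.1,
  clamp (2 - 2 ^+ n * gap n.+1 q))) lambda); last exact: lc.
apply: (@cvg_pair _ _ _ _ (nbhs (_, _)) (nbhs _)); first apply: cvg_pair.
- exact: IH.
- exact: (cvg_comp fst (g_ _) cvg_fst (@g_cont n.+1 q.1)).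
- apply: (@continuous_comp _ _ _ (fun q => 2 - 2 ^+ n * gap n.+1 q) clamp);
    last exact: continuous_clamp.
  apply: cvgB; first exact: cvg_cst.
  exact: continuous_scaled_gap.
Qed.

Lemma interp_next n q : 2 ^+ n * gap n.+1 q <= 1 -> interp n.+1 q = g_ n.+1 q.1.
Proof.
move=> small; case: lambda_equi => _ _ l1 _ /=.
by apply: l1; apply: clamp1; lra.
Qed.

Lemma interp_stay n q : 2 <= 2 ^+ n * gap n.+1 q -> interp n.+1 q = interp n q.
Proof.
move=> large; case: lambda_equi => _ l0 _ _ /=.
by apply: l0; apply: clamp0; lra.
Qed.

Lemma scaled_gap_le m n q : (m <= n)%N ->
  2 ^+ m * gap m.+1 q <= 2 ^+ n * gap n.+1 q.
Proof.
move=> mn; apply: ler_pM; rewrite ?exprn_ge0 ?gap_ge0 //.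
  by rewrite ler_weXn2l // ler1n.
exact: gap_le.
Qed.

Lemma interp_stationary N n q : 2 <= 2 ^+ N * gap N.+1 q -> (N <= n)%N ->
  interp n q = interp N q.
Proof.
move=> large /subnK <-; elim: (n - N)%N => [//|k <-]; rewrite addSn.
by apply/interp_stay/(le_trans large)/scaled_gap_le/leq_addl.
Qed.

Lemma exists_pow2_gt (e c : R) : 0 < e ->
  exists N, forall n, (N <= n)%N -> c < 2 ^+ n * e.
Proof.
move=> e0; have [N _ hN] := nbhs_infty_gtr (c / e).
exists N => n /hN /=; rewrite ltr_pdivrMr // => /lt_le_trans; apply.
rewrite ler_wpM2r ?(ltW e0) // -natrX ler_nat; exact/ltnW/ltn_expl.
Qed.

(** The strict inequality is an open condition on [q], so the same [N] works at all nearby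
    points. *)
Lemma gap_pos_scaled m q : 0 < gap m q -> exists N, 2 < 2 ^+ N * gap N.+1 q.
Proof.
move=> gm; have [N hN] := exists_pow2_gt 2 gm; exists (maxn N m).
apply: lt_le_trans (hN _ (leq_maxl N m)) _.
by rewrite ler_pM2l ?exprn_gt0 // gap_le // leqW // leq_maxr.
Qed.

Lemma interp_is_cvg q : exists z : Z, interp n q @[n --> \oo] --> z.
Proof.
have [[m gm]|nogap] := pselect (exists m, 0 < gap m q).
  have [N /ltW large] := gap_pos_scaled gm.
  exists (interp N q); apply: cvg_near_cst; exists N => // n /=.
  exact: interp_stationary.
(* With all gaps zero every parameter is 1, so each step lands on [g_ n q.1]. *)
exists (g q.1); suff -> : interp ^~ q = g_ ^~ q.1 by [].
apply/funext => -[//|n]; apply: interp_next; rewrite (_ : gap _ _ = 0) ?mulr0 //.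
apply/le_anti; rewrite gap_ge0 andbT leNgt; apply/negP => ?.
by apply: nogap; exists n.+1.
Qed.

(* Since [gap] is nondecreasing and the thresholds decrease geometrically, at
   most one step of [interp _ q] has a parameter strictly between 0 and 1: all
   earlier steps move on to [g_ n q.1], and all later ones are stationary. *)
Lemma interp_near p U : nbhs (g p) U -> exists N, forall q,
  q.1 = p \/ q.2 = p -> 2 ^+ N * gap N.+1 q <= 1 ->
  forall n, (N < n)%N -> U (interp n q).
Proof.
move=> gU; have := equiconnected_tube lambda_equi gU.
move=> [[A B] /= [/(nbhs_metricP d_metric d_open)[e1 e10 A1]
  /(nbhs_metricP d_metric d_open)[e2 e20 B2]] AB].
pose e := Num.min e1 e2.
(* The ball of radius [e] lies in both factors of the tube, so it may contain either endpoint of a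
   step. *)
have e0 : 0 < e by rewrite lt_min e10.
have tube a b t : d (g p) a < e -> d (g p) b < e -> U (lambda (a, b, t)).
  rewrite /e !lt_min => /andP[ae1 ae2] /andP[be1 be2].
  by apply: (AB (a, b)); split; [apply: A1 | apply: B2].
have ball_sub a : d (g p) a < e -> U a.
  case: lambda_equi => _ _ _ lid ae; rewrite -(lid a (clamp 0)); exact: tube.
have [N1 _ hN1] : \forall n \near \oo, d (g p) (g_ n p) < e / 2.
  apply: (iffLR (cvg_metricP d_metric d_open _ _) (@g_lim p)).
  by rewrite divr_gt0.
(* From [2 ^+ m * gap m.+1 q < 2] and [4 < 2 ^+ m * e] it follows that the gap is below [e / 2]. *)
have [N2 hN2] := exists_pow2_gt 4 e0.
pose N := maxn N1 N2; exists N => q qp small.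
(* Compare through [g_ k p]: if [q.1 = p] the second distance is zero, and if [q.2 = p] it is a term
   of the gap. *)
have close m k : (N <= k <= m.+1)%N -> (N <= m)%N ->
    2 ^+ m * gap m.+1 q < 2 -> d (g p) (g_ k q.1) < e.
  move=> /andP[Nk km] Nm gm.
  have gk : d (g p) (g_ k p) < e / 2.
    by apply: hN1; rewrite /= (leq_trans _ Nk) // leq_maxl.
  have pk : d (g_ k p) (g_ k q.1) <= gap m.+1 q.
    case: qp => [->|<-]; first by rewrite dxx gap_ge0.
    by rewrite d_sym; exact: dist_le_gap.
  have ge : gap m.+1 q < e / 2.
    have := hN2 m (leq_trans (leq_maxr _ _) Nm).
    have p0 : 0 < 2 ^+ m :> R by rewrite exprn_gt0.
    by move=> ?; rewrite -(ltr_pM2l p0); lra.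
  by have := d_tri (g_ k p) (g p) (g_ k q.1); lra.
(* Invariant: either the process still sits on [g_ m.+1 q.1], or it is in [U] and the next step is
   already stationary. *)
suff H m : (N <= m)%N ->
    (interp m.+1 q = g_ m.+1 q.1 /\ 2 ^+ m * gap m.+1 q <= 1) \/
    (U (interp m.+1 q) /\ 2 <= 2 ^+ m.+1 * gap m.+2 q).
  case=> [//|m] /[dup] Nm /H[[-> gm]|[]//].
  by apply/ball_sub/(@close m); [rewrite leqnn andbT leqW | | lra].
move=> /subnK <-; elim: (m - N)%N => [|k]; rewrite ?addSn.
  by left; split; first exact: interp_next.
set n := (k + N)%N; have Nn : (N <= n)%N by rewrite leq_addl.
(* The scaled gap at least doubles at each step, so once it exceeds 1 the following one exceeds
   2. *)
have up : 2 * (2 ^+ n.+1 * gap n.+2 q) <= 2 ^+ n.+2 * gap n.+3 q.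
  by rewrite mulrA -exprS ler_pM2l ?exprn_gt0 // gap_le.
have ge0 : 0 <= 2 ^+ n.+1 * gap n.+2 q by rewrite mulr_ge0 ?exprn_ge0 ?gap_ge0.
case=> [[E gn]|[Un gn]]; last first.
  by right; split; [rewrite interp_stay | lra].
have [?|gn1] := leP (2 ^+ n.+1 * gap n.+2 q) 1.
  by left; split; first exact: interp_next.
right; split; last lra.
have gU1 : d (g p) (g_ n.+1 q.1) < e.
  by apply: (@close n); [rewrite leqnn andbT leqW | | lra].
have [large|gn2] := leP 2 (2 ^+ n.+1 * gap n.+2 q).
  by rewrite interp_stay // E; exact: ball_sub.
(* The only possibly fractional step: both endpoints are [e]-close to [g p], and the tube absorbs
   any parameter. *)
rewrite [interp _ _]/= -/(interp n.+1 q) E; apply: tube => //.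
by apply: (@close n.+1); rewrite ?leqnn ?andbT // ?leqW // leqW.
Qed.

(** * The limit map, its diagonal and its separate continuity *)

Lemma separately_continuous_diagonal : exists f : X * X -> Z,
  separately_continuous f /\ forall x, f (x, x) = g x.
Proof.
have [f fP] := choice interp_is_cvg.
have fnear p e : 0 < e -> exists N, forall q, q.1 = p \/ q.2 = p ->
    2 ^+ N * gap N.+1 q <= 1 -> d (g p) (f q) < e.
  move=> e0; have e20 : 0 < e / 2 by rewrite divr_gt0.
  have nb : nbhs (g p) [set z | d (g p) z < e / 2].
    by apply/(nbhs_metricP d_metric d_open); exists (e / 2).
  have [N hN] := interp_near nb.
  exists N => q qp small.
  have /(cvg_metricP d_metric d_open)/(_ _ e20)[M _ hM] := fP q.
  have := hN q qp small (maxn N.+1 M) (leq_maxl _ _).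
  have := hM (maxn N.+1 M) (leq_maxr _ _).
  rewrite /= d_sym.
  by have := d_tri (interp (maxn N.+1 M) q) (g p) (f q); lra.
(* Vanishing gaps satisfy the smallness condition of [fnear] for every [N], hence for every [e]. *)
have feq p q : q.1 = p \/ q.2 = p -> (forall m, gap m q = 0) -> f q = g p.
  move=> qp g0; apply/esym/(metric_small_eq d_metric) => e /(fnear p)[N].
  by apply => //; rewrite g0 mulr0.
(* Continuity along the cross formed by the two lines at [p]; taking [p] as the fixed coordinate
   yields each section. *)
have floc p q : q.1 = p \/ q.2 = p -> forall U, nbhs (f q) U ->
    \forall q' \near q, (q'.1 = p \/ q'.2 = p) -> U (f q').
  move=> qp U nU.
  have [[m gm]|nogap] := pselect (exists m, 0 < gap m q).
    have [N large] := gap_pos_scaled gm.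
    have near_large : \forall q' \near q, 2 < 2 ^+ N * gap N.+1 q'.
      exact: cvgr_gt (@continuous_scaled_gap N q) _ large.
    (* Near [q], [f] coincides with the continuous map [interp N], since limits in [Z] are
       unique. *)
    have fE q' : 2 < 2 ^+ N * gap N.+1 q' -> f q' = interp N q'.
      move=> /ltW large'.
      apply: (cvg_unique (metric_hausdorff d_metric d_open) (fP q')).
      apply: cvg_near_cst; exists N => // n /=; exact: interp_stationary.
    rewrite fE // in nU.
    have := continuous_interp nU.
    by apply: filterS2 near_large => q' /fE -> ? _.
  have g0 m : gap m q = 0.
    apply/le_anti; rewrite gap_ge0 // andbT leNgt; apply/negP => ?.
    by apply: nogap; exists m.
  move: nU; rewrite (feq p) // => /(nbhs_metricP d_metric d_open)[e e0 eU].
  have [N hN] := fnear p e e0.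
  have near_small : \forall q' \near q, 2 ^+ N * gap N.+1 q' < 1.
    by apply: cvgr_lt (@continuous_scaled_gap N q) _ _; rewrite g0 mulr0.
  by apply: filterS near_small => q' /ltW small q'p; apply/eU/hN.
exists f; split; last first.
  by move=> x; apply: feq => [|m]; [left | rewrite /gap big1].
split=> [y x|x y] U nU.
  have c : (x', y) @[x' --> x] --> (x, y).
    by apply: cvg_pair; [exact: cvg_id | exact: cvg_cst].
  apply: (filterS (F := nbhs x)) (c _ (floc y (x, y) (or_intror erefl) U nU)).
  by move=> x'; apply; right.
have c : (x, y') @[y' --> y] --> (x, y).
  by apply: cvg_pair; [exact: cvg_cst | exact: cvg_id].
apply: (filterS (F := nbhs y)) (c _ (floc x (x, y) (or_introl erefl) U nU)).
by move=> y'; apply; left.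
Qed.

End interpolation.

Theorem corollary3p2 (R : realType) (X Z : topologicalType)
    (lambda : Z * Z * unit_interval R -> Z) (g : X -> Z)
    (hZ : metrizable R Z) (hlambda : equiconnected lambda) (hg : B1 X Z g) :
  exists f : X * X -> Z,
    separately_continuous f /\ forall x : X, f (x, x) = g x.
Proof.
case: hZ => d dm dopen; case: hg => g_ gc gl.
exact: separately_continuous_diagonal hlambda dm dopen gc gl.
Qed.
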